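(* Let $k=3$ or $k=\pi$, let $$f_k(x)=\arcsin x-\frac{kx}{2+\sqrt{1-x^2}},\qquad x\in[0,1],$$ and for every integer $m\ge 0$ let $$D_k(m)=\frac{(2m)!}{(m!)^2(2m+1)2^{2m}}-\left(\frac{(-1)^mk}{3^{m+1}}+\sum_{i=0}^{m-1}\frac{k(-1)^{m-1-i}(2i)!}{3^{m-i}\,i!\,(i+1)!\,2^{2i+1}}\right).$$ Then for every positive integer $n$ and every $x\in(0,1)$, $$\sum_{m=0}^{n}D_k(m)x^{2m+1}<f_k(x)<\sum_{m=0}^{n-1}D_k(m)x^{2m+1}+\left(f_k(1)-\sum_{m=0}^{n-1}D_k(m)\right)x^{2n+1}.$$
   Context: An empty sum (the sum over $i$ when $m=0$) equals $0$. *)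

(* Defs.v *)
From Stdlib Require Import Reals Factorial.
Open Scope R_scope.

(* u 0 + ... + u (m - 1), equal to 0 when m = 0
   ([sum_f_R0 u p] has the p + 1 terms u 0, ..., u p). *)
Definition sum_below (u : nat -> R) (m : nat) : R :=
  match m with
  | O => 0
  | S p => sum_f_R0 u p
  end.

(* Only the values on [0, 1] are meaningful: outside [-1, 1], [asin] and [sqrt]
   return default values. *)
Definition f_ (k x : R) : R :=
  asin x - k * x / (2 + sqrt (1 - x ^ 2)).

(* The subtractions in the exponents are on nat; they are never truncated,
   since i < m. *)
Definition D_ (k : R) (m : nat) : R :=
  INR (fact (2 * m)) /
    (INR (fact m) ^ 2 * INR (2 * m + 1) * 2 ^ (2 * m))
  - ((-1) ^ m * k / 3 ^ (m + 1)
     + sum_below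
         (fun i : nat =>
            k * (-1) ^ (m - 1 - i) * INR (fact (2 * i)) /
              (3 ^ (m - i) * INR (fact i) * INR (fact (i + 1))
               * 2 ^ (2 * i + 1)))
         m).

(* Main.v *)
Require Import Defs.
From Stdlib Require Import Reals Factorial Lra Lia Machin.
From Coquelicot Require Import Coquelicot.
Open Scope R_scope.

(** On (-1, 1) the function [f_ k] is the sum of the odd power series with
    coefficients [D_ k m]: the first term of [D_ k m] is the Taylor coefficient
    of the arcsine, and the parenthesis is [k] times the coefficient of [y ^ m]
    in 1 / (2 + sqrt (1 - y)), taken at y = x ^ 2 ([f_series]).

    Everything then rests on the sign of the coefficients: [0 < D_ k m] for
    m >= 2 ([D_pos]). Write p_m for the coefficients of 1 / sqrt (1 - y), and
    b_m = p_m - p_(m+1) = p_m / (2 m + 2). The coefficients c_m of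
    1 / (2 + sqrt (1 - y)) satisfy 3 c_(m+1) + c_m = b_m, and this recurrence
    propagates the two-sided bound b_(m+1) <= 4 c_(m+1) <= b_m: each half gives
    the other half at the next index. Since the arcsine coefficient of index
    m + 1 is b_m (2 m + 1) / (2 m + 3), the bound c_(m+1) <= b_m / 4 gives
    positivity as soon as k / 4 < (2 m + 1) / (2 m + 3), which holds from
    index 5 on; indices 2, 3, 4 are computed. Index 2 is the tightest case: it
    needs k < 81 / 25 = 3.24, which for k = PI follows from PI / 4 = 2 atan (1/3) + atan (1/7)
    and atan x <= x.

    The lower bound of the theorem says that the remainder after the term of
    index n >= 1 is positive. For the upper bound, each x ^ (2 m + 1) in the
    tail m >= n is at most x ^ (2 n + 1), strictly less for m = n + 1
    ([odd_tail_le]); the term of index n itself, which is not positive when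
    n = 1, is left unchanged. The tail of the coefficients is bounded by
    f_k(1) minus a partial sum, because f_k dominates its partial sums on (0, 1)
    and hence, by continuity, at 1 ([f_1_ge_partial_sum]). *)

(** * Coefficients and their recurrences *)

(** The coefficients of 1 / sqrt (1 - y): central binomials over 4 ^ m. *)
Definition cbin (m : nat) : R :=
  INR (fact (2 * m)) / (INR (fact m) ^ 2 * 2 ^ (2 * m)).

(** The coefficients of 1 / (2 + sqrt (1 - y)), defined by the recurrence that
    comes from (3 + y) / (2 + sqrt (1 - y)) = 2 - sqrt (1 - y), where
    sqrt (1 - y) = (1 - y) * (1 / sqrt (1 - y)) has the coefficients
    [cbin (S p) - cbin p] in degree [S p]. *)
Fixpoint recip_coef (m : nat) : R :=
  match m with
  | O => 1 / 3
  | S p => (cbin p - cbin (S p) - recip_coef p) / 3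
  end.

(** The Taylor coefficients of the arcsine, obtained by integrating
    1 / sqrt (1 - x ^ 2). *)
Definition asin_coef (m : nat) : R := cbin m / INR (2 * m + 1).

Lemma cbin_0 : cbin 0 = 1.
Proof. unfold cbin; simpl; field. Qed.

Lemma cbin_S (m : nat) :
  cbin (S m) = cbin m * (2 * INR m + 1) / (2 * INR m + 2).
Proof.
  unfold cbin.
  replace (2 * S m)%nat with (S (S (2 * m))) by lia.
  rewrite !fact_simpl, !mult_INR, !S_INR, mult_INR, <- !tech_pow_Rmult.
  change (INR 2) with 2.
  pose proof (INR_fact_neq_0 m). pose proof (pos_INR m).
  assert (2 ^ (2 * m) <> 0) by (apply pow_nonzero; lra).
  field. repeat split; try assumption; lra.
Qed.

Lemma cbin_pos (m : nat) : 0 < cbin m.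
Proof.
  unfold cbin. apply Rdiv_lt_0_compat; [apply INR_fact_lt_0|].
  apply Rmult_lt_0_compat; apply pow_lt; [apply INR_fact_lt_0 | lra].
Qed.

Lemma cbin_diff (m : nat) :
  cbin m - cbin (S m) = cbin m / (2 * INR m + 2).
Proof.
  rewrite cbin_S. pose proof (pos_INR m). field; lra.
Qed.

Lemma cbin_decr (m : nat) : cbin (S m) < cbin m.
Proof.
  pose proof (cbin_diff m). pose proof (pos_INR m).
  assert (0 < cbin m / (2 * INR m + 2))
    by (apply Rdiv_lt_0_compat; [apply cbin_pos | lra]).
  lra.
Qed.

Lemma cbin_le_1 (m : nat) : cbin m <= 1.
Proof.
  induction m as [|m IH]; [rewrite cbin_0; lra|].
  pose proof (cbin_decr m); lra.
Qed.

(** * Sign of the coefficients *)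

(** With b_m = [cbin m / (2 m + 2)] the recurrence reads 3 c_(m+1) = b_m - c_m.
    Hence b_m <= 4 c_m gives 4 c_(m+1) <= b_m, and 4 c_m <= b_(m-1) gives
    4 c_(m+1) >= b_(m+1) because b_(m-1) + 3 b_(m+1) <= 4 b_m. The last
    inequality fails at m = 1, so the bounds start at index 2. *)
Lemma recip_coef_bounds (m : nat) :
  (1 <= m)%nat ->
  cbin (S m) / (2 * INR (S m) + 2) <= 4 * recip_coef (S m) <= cbin m / (2 * INR m + 2).
Proof.
  induction 1 as [|m Hm IH].
  - cbn [recip_coef]. rewrite !cbin_S, cbin_0. simpl. lra.
  - change (recip_coef (S (S m)))
      with ((cbin (S m) - cbin (S (S m)) - recip_coef (S m)) / 3).
    rewrite cbin_diff.
    split; [|lra].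
    (* the inequality b_m + 3 b_(m+2) <= 4 b_(m+1), in terms of cbin m *)
    assert (cbin m / (2 * INR m + 2) + 3 * (cbin (S (S m)) / (2 * INR (S (S m)) + 2))
            <= 4 * (cbin (S m) / (2 * INR (S m) + 2))); [|lra].
    rewrite !cbin_S, !S_INR.
    apply le_INR in Hm; simpl in Hm.
    pose proof (cbin_pos m) as Hp.
    set (t := INR m) in *. set (p := cbin m) in *.
    apply Rminus_le_0.
    match goal with |- 0 <= ?e => replace e with
      (p * (12 * t - 9) / ((2 * t + 2) * (2 * t + 4) * (2 * t + 6))) by (field; lra) end.
    apply Rmult_le_pos; [apply Rmult_le_pos; lra|].
    left; apply Rinv_0_lt_compat.
    repeat apply Rmult_lt_0_compat; lra.
Qed.

Lemma asin_coef_spec (m : nat) : asin_coef m * (2 * INR m + 1) = cbin m.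
Proof.
  unfold asin_coef. rewrite plus_INR, mult_INR.
  change (INR 2) with 2. change (INR 1) with 1.
  pose proof (pos_INR m). field; lra.
Qed.

Lemma asin_coef_ratio (m : nat) :
  asin_coef (S m) = cbin m / (2 * INR m + 2) * ((2 * INR m + 1) / (2 * INR m + 3)).
Proof.
  unfold asin_coef. rewrite cbin_S, plus_INR, mult_INR, (S_INR m).
  change (INR 2) with 2. change (INR 1) with 1.
  pose proof (pos_INR m). field; lra.
Qed.

(** 68/21 = 4 (2/3 + 1/7), where 1/3 and 1/7 are the leading terms of the two
    arctangent series, which alternate. *)
Lemma PI_le_68_21 : PI <= 68 / 21.
Proof.
  destruct (PI_2_3_7_ineq 0) as [_ H].
  unfold tg_alt, PI_2_3_7_tg, Ratan_seq in H. simpl in H. lra.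
Qed.

(** The asymptotic ratio of the two sides is k / 4 < 1, so the crude bound
    4 c_m <= b_(m-1) suffices once (2 m - 1) / (2 m + 1) > 17/21, that is for
    m >= 5. *)
Lemma asin_coef_gt_recip_coef (k : R) (m : nat) :
  k <= 68 / 21 -> (2 <= m)%nat -> k * recip_coef m < asin_coef m.
Proof.
  intros Hk Hm.
  destruct (Nat.lt_ge_cases m 5) as [Hlt|Hge].
  - assert (Hcase : m = 2%nat \/ m = 3%nat \/ m = 4%nat) by lia.
    destruct Hcase as [-> | [-> | ->]];
      rewrite asin_coef_ratio; cbn [recip_coef]; rewrite !cbin_S, cbin_0; simpl; lra.
  - destruct m as [|m]; [lia|].
    destruct (recip_coef_bounds m) as [Hlow Hup]; [lia|].
    rewrite asin_coef_ratio.
    assert (Ht : 4 <= INR m)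
      by (replace 4 with (INR 4) by (simpl; lra); apply le_INR; lia).
    assert (Hb : 0 < cbin m / (2 * INR m + 2))
      by (apply Rdiv_lt_0_compat; [apply cbin_pos | lra]).
    assert (Hb' : 0 < cbin (S m) / (2 * INR (S m) + 2))
      by (pose proof (pos_INR (S m)); apply Rdiv_lt_0_compat; [apply cbin_pos | lra]).
    set (b := cbin m / (2 * INR m + 2)) in *.
    assert (Hr : 17 / 21 < (2 * INR m + 1) / (2 * INR m + 3))
      by (apply -> Rlt_div_r; lra).
    (* 17/21 is the upper bound 68/21 for k, divided by 4 *)
    apply Rle_lt_trans with (17 / 21 * b); [|nra].
    apply Rle_trans with (68 / 21 * recip_coef (S m)); [|lra].
    apply Rmult_le_compat_r; lra.
Qed.

(** Passing from m to m + 1 multiplies every term of the closed form by -1/3 and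
    adds one new term, k b_m / 3: this is the recurrence defining [recip_coef]. *)
Lemma recip_coef_closed_form (k : R) (m : nat) :
  k * recip_coef m =
  (-1) ^ m * k / 3 ^ (m + 1)
  + sum_below
      (fun i : nat =>
         k * (-1) ^ (m - 1 - i) * INR (fact (2 * i)) /
           (3 ^ (m - i) * INR (fact i) * INR (fact (i + 1)) * 2 ^ (2 * i + 1)))
      m.
Proof.
  set (term := fun m i : nat =>
         k * (-1) ^ (m - 1 - i) * INR (fact (2 * i)) /
           (3 ^ (m - i) * INR (fact i) * INR (fact (i + 1)) * 2 ^ (2 * i + 1))).
  change (k * recip_coef m = (-1) ^ m * k / 3 ^ (m + 1) + sum_below (term m) m).
  (* cbin j - cbin (S j) equals (2 j)! / (j! (j+1)! 2 ^ (2 j + 1)) *)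
  assert (Hnew : forall m, term (S m) m = k * (cbin m - cbin (S m)) / 3).
  { intro j. rewrite cbin_diff. unfold term, cbin.
    replace (S j - 1 - j)%nat with 0%nat by lia.
    replace (S j - j)%nat with 1%nat by lia.
    replace (j + 1)%nat with (S j) by lia.
    rewrite fact_simpl, mult_INR, S_INR, pow_add.
    pose proof (INR_fact_neq_0 j). pose proof (pos_INR j).
    assert (2 ^ (2 * j) <> 0) by (apply pow_nonzero; lra).
    field. repeat split; try assumption; lra. }
  assert (Hold : forall m i, (i < m)%nat -> term (S m) i = term m i * (- / 3)).
  { intros j i Hi. unfold term.
    replace (S j - 1 - i)%nat with (S (j - 1 - i)) by lia.
    replace (S j - i)%nat with (S (j - i)) by lia.
    rewrite <- !tech_pow_Rmult.
    assert (3 ^ (j - i) <> 0) by (apply pow_nonzero; lra).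
    assert (2 ^ (2 * i + 1) <> 0) by (apply pow_nonzero; lra).
    field. repeat split; try assumption; apply INR_fact_neq_0. }
  assert (Hsum : forall m,
    sum_below (term (S m)) (S m)
    = - / 3 * sum_below (term m) m + k * (cbin m - cbin (S m)) / 3).
  { intros [|j].
    - cbn [sum_below sum_f_R0]. rewrite Hnew. ring.
    - cbn [sum_below]. rewrite tech5, Hnew. f_equal.
      rewrite scal_sum. apply sum_eq. intros i Hi. apply Hold. lia. }
  induction m as [|m IH].
  - simpl. field.
  - rewrite Hsum.
    replace (S m + 1)%nat with (S (m + 1)) by lia.
    rewrite <- !tech_pow_Rmult.
    cbn [recip_coef].
    assert (3 ^ (m + 1) <> 0) by (apply pow_nonzero; lra).
    replace (k * ((cbin m - cbin (S m) - recip_coef m) / 3))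
      with (k * (cbin m - cbin (S m)) / 3 - (k * recip_coef m) / 3) by field.
    rewrite IH. field. assumption.
Qed.

Lemma D_coef (k : R) (m : nat) : D_ k m = asin_coef m - k * recip_coef m.
Proof.
  unfold D_. rewrite <- recip_coef_closed_form. f_equal.
  unfold asin_coef, cbin.
  assert (2 ^ (2 * m) <> 0) by (apply pow_nonzero; lra).
  assert (INR (2 * m + 1) <> 0) by (apply not_0_INR; lia).
  pose proof (INR_fact_neq_0 m).
  field. auto.
Qed.

Lemma D_pos (k : R) (m : nat) :
  k = 3 \/ k = PI -> (2 <= m)%nat -> 0 < D_ k m.
Proof.
  intros Hk Hm. rewrite D_coef.
  enough (k * recip_coef m < asin_coef m) by lra.
  apply asin_coef_gt_recip_coef; [|assumption].
  pose proof PI_le_68_21. destruct Hk; lra.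
Qed.

(** * Power series of the function *)

Lemma CV_radius_gt (a : nat -> R) (M y : R) :
  (forall n, Rabs (a n) <= M) -> Rabs y < 1 -> Rbar_lt (Rabs y) (CV_radius a).
Proof.
  intros Ha Hy.
  apply Rbar_lt_le_trans with (Finite 1); [exact Hy|].
  apply (proj1 (CV_radius_bounded a)).
  exists M. intro n. rewrite pow1, Rmult_1_r. apply Ha.
Qed.

Lemma cbin_bounded (m : nat) : Rabs (cbin m) <= 1.
Proof. rewrite Rabs_pos_eq; [apply cbin_le_1 | left; apply cbin_pos]. Qed.

Lemma asin_coef_bounded (m : nat) : Rabs (asin_coef m) <= 1.
Proof.
  unfold asin_coef. pose proof (cbin_pos m). pose proof (cbin_le_1 m).
  assert (1 <= INR (2 * m + 1)) by (apply (le_INR 1); lia).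
  rewrite Rabs_pos_eq.
  - apply <- Rle_div_l; lra.
  - left; apply Rdiv_lt_0_compat; lra.
Qed.

Lemma recip_coef_bounded (m : nat) : Rabs (recip_coef m) <= 1.
Proof.
  apply Rabs_le. induction m as [|m IH]; cbn [recip_coef]; [lra|].
  pose proof (cbin_pos m). pose proof (cbin_le_1 m).
  pose proof (cbin_pos (S m)). pose proof (cbin_le_1 (S m)). lra.
Qed.

Lemma derive_0_const (h : R -> R) (x : R) :
  -1 < x < 1 -> (forall t, -1 < t < 1 -> is_derive h t 0) -> h x = h 0.
Proof.
  intros Hx Hd.
  destruct (Rtotal_order x 0) as [Hlt | [-> | Hgt]]; [| reflexivity |].
  - apply (eq_is_derive h x 0); [|assumption].
    intros t Ht; apply Hd; lra.
  - symmetry. apply (eq_is_derive h 0 x); [|assumption].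
    intros t Ht; apply Hd; lra.
Qed.

(** The recurrence of [cbin] says that P = 1 / sqrt (1 - y) satisfies
    (1 - y) P' = P / 2; together with P (0) = 1 this characterises P. *)
Lemma cbin_series_ode (y : R) :
  Rabs y < 1 ->
  (1 - y) * PSeries (PS_derive cbin) y = / 2 * PSeries cbin y.
Proof.
  intro Hy.
  pose proof (CV_radius_gt cbin 1 y cbin_bounded Hy) as Hr.
  pose proof (CV_radius_inside _ _ Hr) as Hex.
  pose proof (ex_pseries_derive _ _ Hr) as Hexd.
  replace ((1 - y) * PSeries (PS_derive cbin) y)
    with (PSeries (PS_derive cbin) y - y * PSeries (PS_derive cbin) y) by ring.
  rewrite <- PSeries_incr_1, <- PSeries_scal.
  rewrite <- PSeries_minus; [| assumption | apply ex_pseries_incr_1; assumption].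
  apply PSeries_ext. intro m.
  unfold PS_minus, PS_plus, PS_opp, PS_scal, PS_derive, PS_incr_1.
  unfold plus, opp, scal; simpl; unfold mult; simpl.
  destruct m as [|m].
  - rewrite cbin_S, cbin_0. simpl. unfold zero; simpl. field.
  - change (match m with 0%nat => 1 | S _ => INR m + 1 end) with (INR (S m)).
    rewrite (cbin_S (S m)), !S_INR.
    pose proof (pos_INR m). field. lra.
Qed.

Lemma is_derive_sqrt_1m (y : R) :
  y < 1 -> is_derive (fun y => sqrt (1 - y)) y (- / (2 * sqrt (1 - y))).
Proof.
  intro Hy. assert (0 < sqrt (1 - y)) by (apply sqrt_lt_R0; lra).
  auto_derive; [lra|]. unfold Rminus in *. field. lra.
Qed.

(** The product has derivative zero by the differential equation, and it equals
    1 at 0. *)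
Lemma cbin_series (y : R) :
  -1 < y < 1 -> PSeries cbin y * sqrt (1 - y) = 1.
Proof.
  intro Hy.
  rewrite (derive_0_const (fun y => PSeries cbin y * sqrt (1 - y)) y Hy).
  - rewrite PSeries_0, cbin_0, Rminus_0_r, sqrt_1. ring.
  - clear y Hy. intros y Hy.
    assert (Hay : Rabs y < 1) by (apply Rabs_def1; lra).
    assert (Hs : 0 < sqrt (1 - y)) by (apply sqrt_lt_R0; lra).
    evar_last.
    + apply (is_derive_mult (PSeries cbin) (fun y => sqrt (1 - y))).
      * apply is_derive_PSeries, (CV_radius_gt cbin 1 y cbin_bounded Hay).
      * apply is_derive_sqrt_1m. lra.
      * intros; apply Rmult_comm.
    + unfold plus, mult; simpl.
      apply Rmult_eq_reg_r with (sqrt (1 - y)); [|lra].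
      transitivity (sqrt (1 - y) * sqrt (1 - y) * PSeries (PS_derive cbin) y
                    - / 2 * PSeries cbin y).
      * field. lra.
      * rewrite sqrt_sqrt, (cbin_series_ode y Hay) by lra. ring.
Qed.

(** With C the sum of the series, the recurrence becomes (3 + y) C = 2 - s for
    s = sqrt (1 - y), and 3 + y = (2 - s) (2 + s). *)
Lemma recip_coef_series (y : R) :
  -1 < y < 1 -> PSeries recip_coef y = / (2 + sqrt (1 - y)).
Proof.
  intro Hy.
  assert (Hay : Rabs y < 1) by (apply Rabs_def1; lra).
  assert (Hs : 0 < sqrt (1 - y)) by (apply sqrt_lt_R0; lra).
  pose proof (CV_radius_inside _ _ (CV_radius_gt cbin 1 y cbin_bounded Hay)) as Hp.
  pose proof (CV_radius_inside _ _ (CV_radius_gt recip_coef 1 y recip_coef_bounded Hay)) as Hc.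
  assert (Hrec : 3 * PSeries (PS_decr_1 recip_coef) y
            = PSeries cbin y - PSeries (PS_decr_1 cbin) y - PSeries recip_coef y).
  { assert (Hp1 : ex_pseries (PS_decr_1 cbin) y).
    { apply CV_radius_inside. rewrite CV_radius_decr_1.
      exact (CV_radius_gt cbin 1 y cbin_bounded Hay). }
    rewrite <- PSeries_scal.
    rewrite <- PSeries_minus by assumption.
    rewrite <- PSeries_minus; [| apply ex_pseries_minus; assumption | assumption].
    apply PSeries_ext. intro m.
    unfold PS_minus, PS_plus, PS_opp, PS_scal, PS_decr_1.
    unfold plus, opp, scal; simpl; unfold mult; simpl. field. }
  pose proof (PSeries_decr_1 _ _ Hp) as Ep. rewrite cbin_0 in Ep.
  pose proof (PSeries_decr_1 _ _ Hc) as Ec. cbn [recip_coef] in Ec.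
  pose proof (cbin_series y Hy) as E.
  pose proof (sqrt_sqrt (1 - y)) as Hss.
  set (s := sqrt (1 - y)) in *. set (P := PSeries cbin y) in *.
  set (C := PSeries recip_coef y) in *.
  assert (Hs1 : (1 - y) * P = s)
    by (rewrite <- Hss by lra; rewrite Rmult_assoc, (Rmult_comm s P), E; ring).
  assert (Hmain : (3 + y) * C = 2 - s).
  { assert (3 * C = 1 + y * (P - PSeries (PS_decr_1 cbin) y - C))
      by (rewrite <- Hrec; lra).
    lra. }
  assert (Hy3 : 3 + y = (2 - s) * (2 + s)) by (specialize (Hss ltac:(lra)); lra).
  apply Rmult_eq_reg_r with (3 + y); [|lra].
  rewrite Rmult_comm, Hmain, Hy3. field. lra.
Qed.

Lemma is_derive_asin (x : R) :
  -1 < x < 1 -> is_derive asin x (/ sqrt (1 - x ^ 2)).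
Proof.
  intro Hx. apply is_derive_Reals.
  replace (/ sqrt (1 - x ^ 2)) with (derive_pt asin x (derivable_pt_asin x Hx)).
  - apply derive_pt_eq_1 with (derivable_pt_asin x Hx). reflexivity.
  - rewrite derive_pt_asin. unfold Rsqr, Rdiv. rewrite Rmult_1_l. do 3 f_equal. ring.
Qed.

Lemma sq_lt_1 (x : R) : -1 < x < 1 -> 0 <= x ^ 2 < 1.
Proof. intro Hx; nra. Qed.

(** Both sides vanish at 0 and have derivative 1 / sqrt (1 - x ^ 2). *)
Lemma asin_series (x : R) : -1 < x < 1 -> x * PSeries asin_coef (x ^ 2) = asin x.
Proof.
  intro Hx.
  enough (H : x * PSeries asin_coef (x ^ 2) - asin x = 0) by lra.
  rewrite (derive_0_const (fun x => x * PSeries asin_coef (x ^ 2) - asin x) x Hx).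
  { rewrite asin_0. ring. }
  clear x Hx. intros x Hx.
  pose proof (sq_lt_1 x Hx) as Hy.
  assert (Hay : Rabs (x ^ 2) < 1) by (apply Rabs_def1; lra).
  pose proof (CV_radius_gt asin_coef 1 _ asin_coef_bounded Hay) as Hr.
  assert (Hcoef : PSeries asin_coef (x ^ 2) + 2 * (x ^ 2 * PSeries (PS_derive asin_coef) (x ^ 2))
                  = PSeries cbin (x ^ 2)).
  { pose proof (CV_radius_inside _ _ Hr) as Hex.
    pose proof (ex_pseries_derive _ _ Hr) as Hexd.
    rewrite <- PSeries_incr_1, <- PSeries_scal, <- PSeries_plus;
      [| assumption
       | apply ex_pseries_scal; [intros; apply Rmult_comm | apply ex_pseries_incr_1; assumption]].
    apply PSeries_ext. intro m.
    unfold PS_plus, PS_scal, PS_derive, PS_incr_1.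
    rewrite <- (asin_coef_spec m).
    destruct m as [|m]; unfold plus, scal, zero; cbn -[INR asin_coef];
      unfold mult; simpl mult; simpl (INR 0); ring. }
  assert (Hs : 0 < sqrt (1 - x ^ 2)) by (apply sqrt_lt_R0; lra).
  evar_last.
  - apply (is_derive_minus (fun x => x * PSeries asin_coef (x ^ 2)) asin);
      [|apply is_derive_asin; assumption].
    apply (is_derive_mult (fun x => x) (fun x => PSeries asin_coef (x ^ 2)));
      [apply is_derive_id | | intros; apply Rmult_comm].
    apply (is_derive_comp (PSeries asin_coef) (fun x => x ^ 2));
      [apply is_derive_PSeries; exact Hr | apply is_derive_pow, is_derive_id].
  - unfold minus, plus, opp, mult, scal, one; simpl; unfold mult, one; simpl.
    pose proof (cbin_series (x ^ 2) ltac:(lra)) as E.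
    simpl in *.
    replace (/ sqrt (1 - x * (x * 1))) with (PSeries cbin (x * (x * 1))).
    + rewrite <- Hcoef. ring.
    + apply Rmult_eq_reg_r with (sqrt (1 - x * (x * 1))); [|lra].
      rewrite E. field. lra.
Qed.

Lemma f_series (k x : R) :
  -1 < x < 1 -> is_series (fun m => D_ k m * x ^ (2 * m + 1)) (f_ k x).
Proof.
  intro Hx.
  pose proof (sq_lt_1 x Hx) as Hy.
  assert (Hay : Rabs (x ^ 2) < 1) by (apply Rabs_def1; lra).
  pose proof (CV_radius_inside _ _ (CV_radius_gt asin_coef 1 _ asin_coef_bounded Hay)) as Ha.
  pose proof (CV_radius_inside _ _ (CV_radius_gt recip_coef 1 _ recip_coef_bounded Hay)) as Hc.
  unfold f_. rewrite <- asin_series by assumption.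
  unfold Rdiv. rewrite <- recip_coef_series by lra.
  replace (x * PSeries asin_coef (x ^ 2) - k * x * PSeries recip_coef (x ^ 2))
    with (x * PSeries asin_coef (x ^ 2) - (k * x) * PSeries recip_coef (x ^ 2)) by ring.
  eapply is_series_ext;
    [| apply (is_series_minus (V := R_NormedModule));
       [ apply (is_series_scal (V := R_NormedModule) x), PSeries_correct, Ha
       | apply (is_series_scal (V := R_NormedModule) (k * x)), PSeries_correct, Hc ]].
  intro m. rewrite D_coef, pow_add, pow_mult, pow_n_pow.
  unfold minus, plus, opp, scal; simpl; unfold mult; simpl. ring.
Qed.

(** * The endpoint and the remainder *)

(** This is continuity of [f_ k] at 1 from the left. In the variable t with
    x = sin t the function is t - k sin t / (2 + cos t), which is smooth at
    PI / 2, while the arcsine and the square root are singular at the endpoint. *)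
Lemma f_ge_at_1 (k : R) (h : R -> R) :
  continuous h 1 -> (forall x, 0 < x < 1 -> h x <= f_ k x) -> h 1 <= f_ k 1.
Proof.
  intros Hcont Hle.
  pose proof PI2_1 as Hpi.
  set (g := fun t => t - k * sin t / (2 + cos t)).
  assert (Hg : forall t, 0 <= t <= PI / 2 -> f_ k (sin t) = g t).
  { intros t Ht. unfold f_, g.
    rewrite asin_sin by lra.
    replace (1 - sin t ^ 2) with (cos t ^ 2)
      by (pose proof (sin2_cos2 t) as H; unfold Rsqr in H; lra).
    rewrite sqrt_pow2 by (apply cos_ge_0; lra). reflexivity. }
  rewrite <- sin_PI2. rewrite Hg by lra.
  assert (Hgc : continuous g (PI / 2)).
  { apply (ex_derive_continuous g). unfold g. auto_derive. rewrite cos_PI2. lra. }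
  assert (Hhc : continuous (fun t => h (sin t)) (PI / 2)).
  { apply (continuous_comp sin h); [|rewrite sin_PI2; exact Hcont].
    apply (ex_derive_continuous sin). auto_derive. exact I. }
  apply (filterlim_le (F := at_left (PI / 2)) (fun t => h (sin t)) g
           (Finite (h (sin (PI / 2)))) (Finite (g (PI / 2)))).
  - assert (Hd : 0 < PI / 2) by lra.
    exists (mkposreal _ Hd). intros t Hball Ht.
    apply Rabs_def2 in Hball. simpl in Hball.
    unfold minus, plus, opp in Hball; simpl in Hball.
    rewrite <- Hg by lra. apply Hle.
    split; [apply sin_gt_0; lra|].
    rewrite <- sin_PI2. apply sin_increasing_1; lra.
  - eapply filterlim_filter_le_1; [apply (filter_le_within (F := locally (PI / 2))) | exact Hhc].
  - eapply filterlim_filter_le_1; [apply (filter_le_within (F := locally (PI / 2))) | exact Hgc].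
Qed.

Lemma is_series_lt (u : nat -> R) (l : R) (n : nat) :
  is_series u l -> (forall m, (n < m)%nat -> 0 < u m) -> sum_f_R0 u n < l.
Proof.
  intros Hl Hpos.
  assert (Hle : sum_f_R0 u (S n) <= l).
  { apply (is_lim_seq_le_loc (fun _ => sum_f_R0 u (S n)) (sum_n u)
             (Finite (sum_f_R0 u (S n))) (Finite l));
      [| apply is_lim_seq_const | exact Hl].
    exists (S n). intros N HN. rewrite sum_n_Reals.
    induction HN as [|N HN IH]; [lra|].
    rewrite (tech5 u N). pose proof (Hpos (S N) ltac:(lia)). lra. }
  rewrite tech5 in Hle. pose proof (Hpos (S n) ltac:(lia)). lra.
Qed.

Lemma continuous_odd_poly (d : nat -> R) (n : nat) (x : R) :
  continuous (fun x => sum_f_R0 (fun m => d m * x ^ (2 * m + 1)) n) x.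
Proof.
  apply (ex_derive_continuous (fun x => sum_f_R0 (fun m => d m * x ^ (2 * m + 1)) n)).
  induction n as [|n IH]; cbn [sum_f_R0].
  - auto_derive. exact I.
  - apply (ex_derive_plus (fun x => sum_f_R0 (fun m => d m * x ^ (2 * m + 1)) n)
             (fun x => d (S n) * x ^ (2 * S n + 1))); [exact IH|].
    auto_derive. exact I.
Qed.

(** A partial sum up to n >= 1 omits only positive terms, so it is below [f_ k]
    on (0, 1); the inequality passes to the endpoint. *)
Lemma f_1_ge_partial_sum (k : R) (n : nat) :
  k = 3 \/ k = PI -> (1 <= n)%nat -> sum_f_R0 (D_ k) n <= f_ k 1.
Proof.
  intros Hk Hn.
  replace (sum_f_R0 (D_ k) n)
    with (sum_f_R0 (fun m => D_ k m * 1 ^ (2 * m + 1)) n)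
    by (apply sum_eq; intros; rewrite pow1; ring).
  apply (f_ge_at_1 k (fun x => sum_f_R0 (fun m => D_ k m * x ^ (2 * m + 1)) n)).
  - apply continuous_odd_poly.
  - intros x Hx. left. apply is_series_lt; [apply f_series; lra|].
    intros m Hm. apply Rmult_lt_0_compat; [apply D_pos; [assumption|lia] | apply pow_lt; lra].
Qed.

(** Replacing each x ^ (2 m + 1), m > q + 1, by the larger x ^ (2 (q + 1) + 1)
    does not decrease the sum; the second summand on the left records the gain at
    m = q + 2 alone. It keeps the inequality strict when j tends to infinity. *)
Lemma odd_tail_le (d : nat -> R) (x : R) (q j : nat) :
  0 < x < 1 -> (forall m, (q + 2 <= m)%nat -> 0 <= d m) ->
  sum_f_R0 (fun m => d m * x ^ (2 * m + 1)) (q + 2 + j)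
    + x ^ (2 * S q + 1) * ((1 - x ^ 2) * d (q + 2)%nat)
  <= sum_f_R0 (fun m => d m * x ^ (2 * m + 1)) q
     + x ^ (2 * S q + 1) * (sum_f_R0 d (q + 2 + j) - sum_f_R0 d q).
Proof.
  intros Hx Hd. induction j as [|j IH].
  - replace (q + 2 + 0)%nat with (S (S q)) by lia.
    replace (q + 2)%nat with (S (S q)) by lia.
    rewrite !tech5.
    replace (2 * S (S q) + 1)%nat with (2 * S q + 1 + 2)%nat by lia.
    rewrite (pow_add x (2 * S q + 1) 2). apply Req_le. ring.
  - replace (q + 2 + S j)%nat with (S (q + 2 + j)) by lia.
    rewrite !tech5.
    set (N := S (q + 2 + j)) in *.
    assert (Hpow : x ^ (2 * N + 1) <= x ^ (2 * S q + 1)).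
    { replace (2 * N + 1)%nat with (2 * S q + 1 + 2 * (N - S q))%nat by lia.
      rewrite pow_add. rewrite <- (Rmult_1_r (x ^ (2 * S q + 1))) at 2.
      apply Rmult_le_compat_l; [apply pow_le; lra|].
      rewrite <- (pow1 (2 * (N - S q))). apply pow_incr. lra. }
    assert (Hd' : 0 <= d N) by (apply Hd; lia).
    pose proof (Rmult_le_compat_l _ _ _ Hd' Hpow). lra.
Qed.

Theorem theorem8 :
  forall (k : R), k = 3 \/ k = PI ->
  forall (n : nat), (1 <= n)%nat ->
  forall (x : R), 0 < x < 1 ->
    sum_f_R0 (fun m : nat => D_ k m * x ^ (2 * m + 1)) n < f_ k x
    /\
    f_ k x <
      sum_f_R0 (fun m : nat => D_ k m * x ^ (2 * m + 1)) (n - 1)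
      + (f_ k 1 - sum_f_R0 (fun m : nat => D_ k m) (n - 1)) * x ^ (2 * n + 1).
Proof.
  intros k Hk n Hn x Hx.
  pose proof (f_series k x ltac:(lra)) as Hser.
  split.
  - apply is_series_lt; [exact Hser|].
    intros m Hm. apply Rmult_lt_0_compat; [apply D_pos; [assumption|lia] | apply pow_lt; lra].
  - destruct n as [|q]; [lia|].
    replace (S q - 1)%nat with q by lia.
    set (u := fun m : nat => D_ k m * x ^ (2 * m + 1)) in *.
    change (fun m : nat => D_ k m) with (D_ k).
    set (X := x ^ (2 * S q + 1)).
    set (gap := X * ((1 - x ^ 2) * D_ k (q + 2))).
    assert (HX : 0 < X) by (apply pow_lt; lra).
    assert (Hgap : 0 < gap).
    { apply Rmult_lt_0_compat; [exact HX|]. apply Rmult_lt_0_compat.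
      - nra.
      - apply D_pos; [assumption|lia]. }
    set (B := sum_f_R0 u q + (f_ k 1 - sum_f_R0 (D_ k) q) * X).
    enough (f_ k x <= B - gap) by lra.
    apply (is_lim_seq_le_loc (sum_n u) (fun _ => B - gap) (Finite (f_ k x)) (Finite (B - gap)));
      [| exact Hser | apply is_lim_seq_const].
    exists (q + 2)%nat. intros N HN. rewrite sum_n_Reals.
    replace N with (q + 2 + (N - (q + 2)))%nat by lia.
    set (j := (N - (q + 2))%nat).
    pose proof (odd_tail_le (D_ k) x q j Hx) as Htail.
    fold u X gap in Htail.
    assert (Hnn : forall m, (q + 2 <= m)%nat -> 0 <= D_ k m)
      by (intros m Hm; left; apply D_pos; [assumption|lia]).
    specialize (Htail Hnn).
    pose proof (f_1_ge_partial_sum k (q + 2 + j) Hk ltac:(lia)) as H1.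
    assert (X * (sum_f_R0 (D_ k) (q + 2 + j) - sum_f_R0 (D_ k) q)
            <= X * (f_ k 1 - sum_f_R0 (D_ k) q)) by (apply Rmult_le_compat_l; lra).
    unfold B. lra.
Qed.
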